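(* Let $k$ be a field, let $Q\subseteq\mathbb{Z}^d$ be a normal affine semigroup that generates $\mathbb{Z}^d$ as a group and has trivial unit group, and let $I\subseteq k[Q]$ be a reduced (i.e. radical) monomial ideal. Every summand in the minimal irreducible resolution of the quotient $k[Q]/I$ is isomorphic to $k[F]$ for some face $F$ of $Q$.
   Context: All modules are $\mathbb{Z}^d$-graded $k[Q]$-modules, with degree-preserving homomorphisms; graded ideals of $k[Q]$ are monomial ideals. $\mathbf{x}^a$ denotes the monomial with exponent $a$. A face of $Q$ is a subset $F=\{a\in Q\mid\ell(a)=0\}$ for a linear functional $\ell$ on $\mathbb{Z}^d$ that is nonnegative on $Q$ (so $Q$ and $\{\mathbf 0\}$ are faces). The semigroup ring $k[F]$ is regarded as the quotient module of $k[Q]$ by the prime ideal spanned by $\mathbf{x}^a$, $a\in Q\smallsetminus F$. An ideal $W\subseteq k[Q]$ is irreducible if it cannot be expressed as an intersection of two ideals properly containing it. An irreducible resolution of a module $M$ is an exact sequence $0\to M\to\overline{W}^0\to\overline{W}^1\to\cdots$ with $\overline{W}^i=\bigoplus_{j=1}^{\mu_i}k[Q]/W^{ij}$, where each $W^{ij}$ is an irreducible ideal of $k[Q]$; the summands of the resolution are the modules $k[Q]/W^{ij}$. It is minimal if all the numbers $\mu_i$ are simultaneously minimized among irreducible resolutions of $M$. A minimal irreducible resolution of a finitely generated $Q$-graded module (one with nonzero components only in degrees in $Q$) exists and is unique up to isomorphism. *)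

(* Defs.v *)
From HB Require Import structures.
From mathcomp Require Import all_boot all_order all_algebra finmap.
From mathcomp Require Import generic_quotient ring_quotient monalg.

Set Implicit Arguments.
Unset Strict Implicit.
Unset Printing Implicit Defensive.

Import Order.TTheory GRing.Theory Num.Theory.

Local Open Scope ring_scope.
Local Open Scope quotient_scope.

(* Submonoids of Z^d with trivial unit group.  Pointedness is bundled because
   [monomType], the exponent structure of [{malg _[_]}], requires it. *)

Record pmonoid (d : nat) := PMonoid {
  pmonoid_pred :> addrClosed 'rV[int]_d;
  pmonoid_pointed : forall a, a \in pmonoid_pred -> - a \in pmonoid_pred -> a = 0
}.

Section Semigroup.
Variables (d : nat) (Q : pmonoid d).

Definition affine_monoid : Prop :=
  exists (n : nat) (g : 'I_n -> 'rV[int]_d), forall a : 'rV[int]_d,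
    a \in Q <-> exists c : 'I_n -> nat, a = \sum_i g i *+ c i.

Definition in_group (a : 'rV[int]_d) : Prop :=
  exists b c : 'rV[int]_d, [/\ b \in Q, c \in Q & a = b - c].

Definition generates : Prop := forall a, in_group a.

Definition normal_monoid : Prop :=
  forall (n : nat) (a : 'rV[int]_d),
    (0 < n)%N -> in_group a -> a *+ n \in Q -> a \in Q.

(* A [face] is a subset of Z^d contained in Q; [l] is a Z-linear functional. *)
Record face := Face {
  face_pred :> {pred 'rV[int]_d};
  faceP : exists l : {scalar 'rV[int]_d},
    {in Q, forall a, 0 <= l a} /\
    forall a, (a \in face_pred) = (a \in Q) && (l a == 0)
}.

Record elt := Elt { eval :> 'rV[int]_d; eltP : eval \in Q }.

HB.instance Definition _ := [isSub for eval].
HB.instance Definition _ := [Choice of elt by <:].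

Definition elt0 := Elt (rpred0 (pmonoid_pred Q)).
Definition eltD (a b : elt) := Elt (rpredD (eltP a) (eltP b)).

Fact eltDA : associative eltD.
Proof. by move=> a b c; apply: val_inj; rewrite /= addrA. Qed.
Fact eltDC : commutative eltD.
Proof. by move=> a b; apply: val_inj; rewrite /= addrC. Qed.
Fact elt0D : left_id elt0 eltD.
Proof. by move=> a; apply: val_inj; rewrite /= add0r. Qed.
Fact eltD0 : right_id elt0 eltD.
Proof. by move=> a; rewrite eltDC elt0D. Qed.
Fact elt_unit a b : eltD a b = elt0 -> a = elt0 /\ b = elt0.
Proof.
move=> /(congr1 eval) /= ab0.
have bE : eval b = - eval a by rewrite -[RHS]addr0 -ab0 addKr.
have a0 : eval a = 0 by apply: pmonoid_pointed (eltP a) _; rewrite -bE eltP.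
by split; apply: val_inj; rewrite //= bE a0 oppr0.
Qed.

HB.instance Definition _ :=
  Choice_isMonomialDef.Build elt eltDA elt0D eltD0 elt_unit.
HB.instance Definition _ := MonomialDef_isConomialDef.Build elt eltDC.

End Semigroup.

(* Ideals of a commutative ring; unlike [idealr], they may contain 1. *)

Record ideal (R : comNzRingType) := Ideal {
  ideal_pred :> zmodClosed R;
  idealM : forall r, {in ideal_pred, forall u, r * u \in ideal_pred}
}.

Section Ideals.
Variable R : comNzRingType.
Implicit Types I J K W : ideal R.

Definition properly_contains J W : Prop :=
  {subset W <= J} /\ ~ {subset J <= W}.

(* The two larger ideals range over all ideals of the ring, homogeneous or not,
   and the unit ideal is (vacuously) irreducible. *)
Definition irreducible W : Prop :=
  ~ exists J K, [/\ properly_contains J W, properly_contains K W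
                  & forall f, (f \in W) = (f \in J) && (f \in K)].

(* The case n = 0 is harmless: 1 \in I already forces f \in I. *)
Definition radical I : Prop := forall f n, f ^+ n \in I -> f \in I.

Definition quotmod I : Type := {ideal_quot (ideal_pred I)}.

Section QuotMod.
Variable I : ideal R.

HB.instance Definition _ := GRing.Zmodule.on (quotmod I).

Definition pi (f : R) : quotmod I := \pi_({ideal_quot (ideal_pred I)}) f.

Lemma pi_surj (x : quotmod I) : exists f, x = pi f.
Proof. by exists (repr x); rewrite /pi reprK. Qed.

Lemma pi_eq f g : pi f = pi g <-> f - g \in I.
Proof.
rewrite /pi; split=> [/eqP|fg]; first by rewrite -Quotient.idealrBE.
by apply/eqP; rewrite -Quotient.idealrBE.
Qed.

Lemma pi0 : pi 0 = 0.
Proof. exact: raddf0. Qed.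

Lemma piB f g : pi (f - g) = pi f - pi g.
Proof. exact: raddfB. Qed.

Lemma piD f g : pi (f + g) = pi f + pi g.
Proof. exact: raddfD. Qed.

Lemma pi_sum (A : Type) (s : seq A) (F : A -> R) :
  pi (\sum_(i <- s) F i) = \sum_(i <- s) pi (F i).
Proof. exact: raddf_sum. Qed.

Definition quot_scale (r : R) (x : quotmod I) : quotmod I := pi (r * repr x).

Lemma quot_scale_pi r f : quot_scale r (pi f) = pi (r * f).
Proof.
apply/pi_eq; rewrite -mulrBr; apply: idealM; apply/pi_eq.
by rewrite /pi reprK.
Qed.

Fact quot_scaleA a b x : quot_scale a (quot_scale b x) = quot_scale (a * b) x.
Proof. by have [f ->] := pi_surj x; rewrite !quot_scale_pi mulrA. Qed.
Fact quot_scale1 : left_id 1 quot_scale.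
Proof. by move=> x; have [f ->] := pi_surj x; rewrite quot_scale_pi mul1r. Qed.
Fact quot_scaleDr : right_distributive quot_scale +%R.
Proof.
move=> a x y; have [f ->] := pi_surj x; have [g ->] := pi_surj y.
by rewrite -piD !quot_scale_pi mulrDr piD.
Qed.
Fact quot_scaleDl x : {morph quot_scale^~ x : a b / a + b}.
Proof.
by move=> a b; have [f ->] := pi_surj x; rewrite !quot_scale_pi mulrDl piD.
Qed.

HB.instance Definition _ := GRing.Zmodule_isLmodule.Build R (quotmod I)
  quot_scaleA quot_scale1 quot_scaleDr quot_scaleDl.

Lemma pi_scale r f : r *: pi f = pi (r * f).
Proof. exact: quot_scale_pi. Qed.

End QuotMod.

Section DirectSum.
Variables (n : nat) (T : 'I_n -> lmodType R).

Definition dsum : Type := {dffun forall j, T j}.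
HB.instance Definition _ := Choice.on dsum.

Definition dsum_mk (v : forall j, T j) : dsum := [ffun j => v j].
Definition dsum_coord (v : dsum) (j : 'I_n) : T j := fun_of_fin v j.

Lemma dsumE v j : dsum_coord (dsum_mk v) j = v j.
Proof. exact: ffunE. Qed.

Lemma dsumP u v : (forall j, dsum_coord u j = dsum_coord v j) -> u = v.
Proof. by move=> uv; apply/ffunP. Qed.

Definition dsum0 := dsum_mk (fun j => 0).
Definition dsumN (v : dsum) := dsum_mk (fun j => - dsum_coord v j).
Definition dsumD (u v : dsum) := dsum_mk (fun j => dsum_coord u j + dsum_coord v j).
Definition dsumZ r (v : dsum) := dsum_mk (fun j => r *: dsum_coord v j).

Fact dsumDA : associative dsumD.
Proof. by move=> u v w; apply: dsumP => j; rewrite !dsumE addrA. Qed.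
Fact dsumDC : commutative dsumD.
Proof. by move=> u v; apply: dsumP => j; rewrite !dsumE addrC. Qed.
Fact dsum0D : left_id dsum0 dsumD.
Proof. by move=> u; apply: dsumP => j; rewrite !dsumE add0r. Qed.
Fact dsumND : left_inverse dsum0 dsumN dsumD.
Proof. by move=> u; apply: dsumP => j; rewrite !dsumE addNr. Qed.

HB.instance Definition _ :=
  GRing.isZmodule.Build dsum dsumDA dsumDC dsum0D dsumND.

Fact dsumZA a b v : dsumZ a (dsumZ b v) = dsumZ (a * b) v.
Proof. by apply: dsumP => j; rewrite !dsumE scalerA. Qed.
Fact dsumZ1 : left_id 1 dsumZ.
Proof. by move=> v; apply: dsumP => j; rewrite !dsumE scale1r. Qed.
Fact dsumZDr : right_distributive dsumZ +%R.
Proof. by move=> a u v; apply: dsumP => j; rewrite !dsumE scalerDr. Qed.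
Fact dsumZDl v : {morph dsumZ^~ v : a b / a + b}.
Proof. by move=> a b; apply: dsumP => j; rewrite !dsumE scalerDl. Qed.

HB.instance Definition _ :=
  GRing.Zmodule_isLmodule.Build R dsum dsumZA dsumZ1 dsumZDr dsumZDl.

Lemma dsum_coord0 j : dsum_coord 0 j = 0.
Proof. exact: dsumE. Qed.
Lemma dsum_coordD u v j : dsum_coord (u + v) j = dsum_coord u j + dsum_coord v j.
Proof. exact: dsumE. Qed.
Lemma dsum_coordN v j : dsum_coord (- v) j = - dsum_coord v j.
Proof. exact: dsumE. Qed.
Lemma dsum_coordZ r v j : dsum_coord (r *: v) j = r *: dsum_coord v j.
Proof. exact: dsumE. Qed.
Lemma dsum_coord_sum (A : Type) (s : seq A) (F : A -> dsum) j :
  dsum_coord (\sum_(i <- s) F i) j = \sum_(i <- s) dsum_coord (F i) j.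
Proof.
elim: s => [|a s IHs]; first by rewrite !big_nil dsum_coord0.
by rewrite !big_cons dsum_coordD IHs.
Qed.

End DirectSum.
End Ideals.

Fact monom_scale (k : fieldType) (M : conomType) (c : k) (b : M) :
  << c *g b >> = c%:MP * << b >> :> {malg k[M]}.
Proof.
by rewrite mul_malgC; apply/malgP => x; rewrite mcoeffZ !mcoeffU mulrnAr mulr1.
Qed.

Section Graded.
Variables (k : fieldType) (d : nat) (Q : pmonoid d).

(* The semigroup ring k[Q]; the monomial x^q is << q >>. *)
Local Notation kQ := {malg k[elt Q]}.
Local Notation Zd := 'rV[int]_d.

(* [gcomp a] is the component of degree a.  The last two fields say that the
   module is the direct sum of its components. *)
Record gmodule := GModule {
  gcarrier :> lmodType kQ;
  gcomp : Zd -> gcarrier -> Prop;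
  gcomp0 : forall a, gcomp a 0;
  gcompB : forall a u v, gcomp a u -> gcomp a v -> gcomp a (u - v);
  gcompZ : forall (c : k) (q : elt Q) a v,
    gcomp a v -> gcomp (eval q + a) (<< c *g q >> *: v);
  gcomp_span : forall v, exists (s : {fset Zd}) (w : Zd -> gcarrier),
    (forall a, gcomp a (w a)) /\ v = \sum_(a <- s) w a;
  gcomp_indep : forall (s : {fset Zd}) (w : Zd -> gcarrier),
    (forall a, gcomp a (w a)) -> \sum_(a <- s) w a = 0 ->
    {in s, forall a, w a = 0}
}.

Record ghom (M N : gmodule) := GHom {
  ghom_fun :> {linear M -> N};
  ghomP : forall a v, gcomp a v -> gcomp a (ghom_fun v)
}.

Definition giso (M N : gmodule) : Prop :=
  exists (f : ghom M N) (g : ghom N M), cancel f g /\ cancel g f.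

Record monideal := MonIdeal {
  monideal_ideal :> ideal kQ;
  monidealP : {in monideal_ideal, forall f, forall a : elt Q,
    a \in msupp f -> << a >> \in monideal_ideal}
}.

Definition homog (a : Zd) (f : kQ) : Prop :=
  forall b : elt Q, b \in msupp f -> eval b = a.

Section QuotientGrading.
Variable W : monideal.

Definition quot_comp (a : Zd) (x : quotmod W) : Prop :=
  exists2 f, homog a f & x = pi W f.

Fact quot_comp0 a : quot_comp a 0.
Proof.
exists 0; first by move=> b; rewrite msupp0 in_fset0.
by rewrite pi0.
Qed.

Fact quot_compB a u v :
  quot_comp a u -> quot_comp a v -> quot_comp a (u - v).
Proof.
case=> f fa -> [g ga ->]; exists (f - g); last by rewrite piB.
move=> b /(fsubsetP (msuppB_le _ _)); rewrite in_fsetU.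
by case/orP; [apply: fa | apply: ga].
Qed.

Fact quot_compZ (c : k) (q : elt Q) a v :
  quot_comp a v -> quot_comp (eval q + a) (<< c *g q >> *: v).
Proof.
case=> f fa ->; exists (<< c *g q >> * f); last exact: pi_scale.
move=> b /msuppM_le[b1 [b2 [b1P b2P ->]]] /=.
by rewrite (fa _ b2P); move/(fsubsetP msuppU_le): b1P; rewrite in_fset1 => /eqP ->.
Qed.

Definition hpart (f : kQ) (a : Zd) : kQ :=
  \sum_(b <- msupp f | eval b == a) << f@_b *g b >>.

Fact homog_hpart f a : homog a (hpart f a).
Proof.
move=> b; rewrite -mcoeff_neq0 raddf_sum /=.
move=> nz; apply/eqP; apply: contraNT nz => ba; apply/eqP/big1 => c /eqP ca.
by rewrite mcoeffU; case: eqP => // cb; case/eqP: ba; rewrite -cb.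
Qed.

Fact quot_comp_span v : exists (s : {fset Zd}) (w : Zd -> quotmod W),
  (forall a, quot_comp a (w a)) /\ v = \sum_(a <- s) w a.
Proof.
have [f ->] := pi_surj v.
exists [fset eval b | b in msupp f]%fset, (fun a => pi W (hpart f a)); split.
  by move=> a; exists (hpart f a) => //; apply: homog_hpart.
rewrite -pi_sum; congr pi; rewrite {1}[f]monalgE.
rewrite (partition_big_imfset _ (fun b : elt Q => eval b)) /=.
by apply: eq_bigr.
Qed.

Fact quot_comp_indep (s : {fset Zd}) (w : Zd -> quotmod W) :
  (forall a, quot_comp a (w a)) -> \sum_(a <- s) w a = 0 ->
  {in s, forall a, w a = 0}.
Proof.
move=> wP w0.
have /fin_all_exists[g gP] : forall a : s, exists f : kQ,
    homog (val a) f /\ w (val a) = pi W f.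
  by move=> a; have [f] := wP (val a); exists f.
have sumgW : \sum_a g a \in ideal_pred W.
  rewrite -[\sum_a g a]subr0; apply/pi_eq.
  rewrite pi_sum pi0 -[RHS]w0 [RHS]big_seq_fsetE.
  by apply: eq_bigr => a _; have [_ ->] := gP a.
move=> a sa; have [ga wa] := gP [` sa]%fset; rewrite [w a]wa.
rewrite -(pi0 W); apply/pi_eq; rewrite subr0 [g _]monalgE big_seq.
apply: rpred_sum => b bP; rewrite monom_scale.
apply: idealM; apply: (monidealP sumgW).
rewrite -mcoeff_neq0 raddf_sum (bigD1 [` sa]%fset) //= big1 ?addr0 ?mcoeff_neq0 //.
move=> c ca; apply/eqP; rewrite mcoeff_eq0; apply: contra ca => bc.
by apply/eqP/val_inj; have <- := proj1 (gP c) _ bc; apply: ga.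
Qed.

Definition gquot : gmodule :=
  GModule quot_comp0 quot_compB quot_compZ quot_comp_span quot_comp_indep.

End QuotientGrading.

Section DirectSumGrading.
Variables (n : nat) (T : 'I_n -> gmodule).

Definition dsum_comp (a : Zd) (v : dsum T) : Prop :=
  forall j, gcomp a (dsum_coord v j).

Fact dsum_comp0 a : dsum_comp a 0.
Proof. by move=> j; rewrite dsum_coord0; apply: gcomp0. Qed.

Fact dsum_compB a u v : dsum_comp a u -> dsum_comp a v -> dsum_comp a (u - v).
Proof.
by move=> ua va j; rewrite dsum_coordD dsum_coordN; apply: gcompB.
Qed.

Fact dsum_compZ (c : k) (q : elt Q) a v :
  dsum_comp a v -> dsum_comp (eval q + a) (<< c *g q >> *: v).
Proof. by move=> va j; rewrite dsum_coordZ; apply: gcompZ. Qed.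

Fact dsum_comp_span v : exists (s : {fset Zd}) (w : Zd -> dsum T),
  (forall a, dsum_comp a (w a)) /\ v = \sum_(a <- s) w a.
Proof.
have [s sP] := fin_all_exists (fun j => gcomp_span (dsum_coord v j)).
have [w wP] := fin_all_exists sP.
pose w' a := dsum_mk (fun j => if a \in s j then w j a else 0).
exists (\bigcup_(j <- index_enum 'I_n) s j)%fset, w'; split=> [a j|].
  rewrite dsumE; case: ifP => _; last exact: gcomp0.
  by have [] := wP j.
apply: dsumP => j; rewrite dsum_coord_sum; have [_ ->] := wP j.
have sj := bigfcup_sup s (mem_index_enum j) isT.
rewrite -(big_fset_incl _ sj) => [|a _ /negPf asj]; last by rewrite dsumE asj.
by rewrite !big_seq; apply: eq_bigr => a asj; rewrite dsumE asj.
Qed.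

Fact dsum_comp_indep (s : {fset Zd}) (w : Zd -> dsum T) :
  (forall a, dsum_comp a (w a)) -> \sum_(a <- s) w a = 0 ->
  {in s, forall a, w a = 0}.
Proof.
move=> wP w0 a sa; apply: dsumP => j; rewrite dsum_coord0.
apply: (gcomp_indep (w := fun b => dsum_coord (w b) j)) sa => // [b|].
  exact: wP.
by rewrite -dsum_coord_sum w0 dsum_coord0.
Qed.

Definition gdsum : gmodule :=
  GModule dsum_comp0 dsum_compB dsum_compZ dsum_comp_span dsum_comp_indep.

End DirectSumGrading.

(* k[F] is the quotient of k[Q] by the span of the x^a with a in Q \ F. *)

Section FaceIdeal.
Variable F : face Q.

Definition face_ideal_pred : {pred kQ} :=
  fun f => all (fun b : elt Q => eval b \notin F) (msupp f).

Fact face_ideal_zmod : zmod_closed face_ideal_pred.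
Proof.
split=> [|f g /allP fP /allP gP]; first by apply/allP => b; rewrite msupp0 in_fset0.
apply/allP => b /(fsubsetP (msuppB_le _ _)); rewrite in_fsetU.
by case/orP; [apply: fP | apply: gP].
Qed.
HB.instance Definition _ := GRing.isZmodClosed.Build kQ face_ideal_pred face_ideal_zmod.

Fact face_idealM r : {in face_ideal_pred, forall f, r * f \in face_ideal_pred}.
Proof.
move=> f /allP fP; apply/allP => b /msuppM_le[b1 [b2 [_ /fP b2P ->]]] /=.
have [l [lQ lF]] := faceP F; move: b2P; rewrite !lF !rpredD ?eltP //= raddfD.
by apply: contra; rewrite paddr_eq0 ?lQ ?eltP // => /andP[].
Qed.

Fact face_ideal_monomial : {in Ideal face_idealM, forall f, forall a : elt Q,
  a \in msupp f -> << a >> \in Ideal face_idealM}.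
Proof.
move=> f /allP fP a af; apply/allP => b /(fsubsetP msuppU_le).
by rewrite in_fset1 => /eqP ->; apply: fP.
Qed.

Definition face_ideal : monideal := MonIdeal face_ideal_monomial.

Definition face_module : gmodule := gquot face_ideal.

End FaceIdeal.

(* 0 -> M -> term 0 -> term 1 -> ..., of possibly infinite length; mu i may be 0,
   so finite resolutions are included. *)
Record irr_resolution (M : gmodule) := IrrResolution {
  mu : nat -> nat;
  irr_ideal : forall i, 'I_(mu i) -> monideal;
  summand i (j : 'I_(mu i)) : gmodule := gquot (irr_ideal j);
  term i : gmodule := gdsum (@summand i);
  augmentation : ghom M (term 0);
  differential : forall i, ghom (term i) (term i.+1);
  irr_idealP : forall i (j : 'I_(mu i)), irreducible (irr_ideal j);
  augmentation_inj : injective augmentation;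
  exact_term0 : forall v, differential 0 v = 0 <-> exists m, v = augmentation m;
  exact_termS : forall i v,
    differential i.+1 v = 0 <-> exists u, v = differential i u
}.

Definition minimal_resolution (M : gmodule) (R : irr_resolution M) : Prop :=
  forall (R' : irr_resolution M) (i : nat), (mu R i <= mu R' i)%N.

End Graded.

(* Main.v *)
(* A degree-preserving map between quotients k[Q]/W and k[Q]/V is multiplication
   by a scalar, so a map from k[Q]/W, with W irreducible, to a direct sum of such
   quotients either splits or kills a monomial outside W.  If the differential of
   a resolution splits on a summand, that summand can be cancelled from its term,
   at the cost of enlarging the term two steps later; hence in a minimal resolution
   each summand of each term i contains a monomial of the i-th cosyzygy.

   Call W face-closed if x^(q+a) in W implies x^a in W whenever q lies in the face
   generated by a (compare Yanagawa's squarefree modules).  A radical monomial ideal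
   is face-closed.  Inductively, if all ideals in term i are face-closed, then
   multiplication by such x^q is injective on degree a of the (i+1)-st cosyzygy, and
   by essentiality the ideals in term i+1 are face-closed as well.  The exponents
   outside a face-closed irreducible ideal are closed under sums and summands, and
   Farkas' lemma over Z supplies a functional exposing them as a face. *)

From HB Require Import structures.
From Stdlib Require Import Classical.
From mathcomp Require Import all_boot all_order all_algebra finmap monalg.
From mathcomp Require Import zify ring.
Require Import Defs.

Set Implicit Arguments.
Unset Strict Implicit.
Unset Printing Implicit Defensive.

Import Order.TTheory GRing.Theory Num.Theory.

Local Open Scope ring_scope.

(** * Farkas' lemma over the integers *)

Section Farkas.
Variable d : nat.
Local Notation Zd := 'rV[int]_d.
Implicit Types (s : seq Zd) (b u v x : Zd) (l : {scalar 'rV[int]_d}).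

(** The monoid generated by [s]; recursion on the list peels off one generator at a time, as the
    induction in [farkas] does. *)
Fixpoint ncone s v : Prop :=
  if s is x :: s' then exists n : nat, ncone s' (v - x *+ n) else v = 0.

Lemma ncone0 s : ncone s 0.
Proof. by elim: s => //= x s IHs; exists 0%N; rewrite mulr0n subr0. Qed.

Lemma nconeD s u v : ncone s u -> ncone s v -> ncone s (u + v).
Proof.
elim: s u v => [|x s IHs] u v /=; first by move=> -> ->; rewrite addr0.
case=> m um [n vn]; exists (m + n)%N.
by rewrite mulrnDr opprD addrACA; apply: IHs.
Qed.

Lemma nconeMn s u n : ncone s u -> ncone s (u *+ n).
Proof.
move=> su; elim: n => [|n IHn]; first by rewrite mulr0n; apply: ncone0.
by rewrite mulrS; apply: nconeD.
Qed.

Lemma scalar_comb l1 l2 (c1 c2 : int) :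
  exists l, forall v, l v = c1 * l1 v + c2 * l2 v.
Proof.
have lin : scalar (fun v => c1 * l1 v + c2 * l2 v).
  by move=> a u v; rewrite !linearP /=; ring.
pose L := GRing.isLinear.Build _ _ _ _ _ lin.
pose l : {scalar Zd} := HB.pack (fun v => c1 * l1 v + c2 * l2 v) L.
by exists l.
Qed.

Lemma scalar_coord (j : 'I_d) (c : int) : exists l, forall v, l v = c * v 0 j.
Proof.
have lin : scalar (fun v : Zd => c * v 0 j).
  by move=> a u v; rewrite !mxE; ring.
pose L := GRing.isLinear.Build _ _ _ _ _ lin.
pose l : {scalar Zd} := HB.pack (fun v : Zd => c * v 0 j) L.
by exists l.
Qed.

(** Each modified generator is a multiple of [v] plus a nonnegative multiple of [x], and the latter
    add up to [c]. This turns a cone over projected vectors back into one over [s] and [x]. *)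
Lemma ncone_map s (l : {scalar Zd}) (x w : Zd) (p : nat) :
    {in s, forall v, 0 <= l v} ->
    ncone [seq v *+ p + x *~ l v | v <- s] w ->
  exists2 u, ncone s u & exists c : nat, w = u *+ p + x *+ c.
Proof.
elim: s w => [|v s IHs] w lp /=.
  by move=> ->; exists 0 => //; exists 0%N; rewrite mulr0n mul0rn addr0.
case=> n /IHs[|u su [c wE]].
  by move=> z zs; apply: lp; rewrite inE zs orbT.
exists (u + v *+ n); first by exists n; rewrite addrK.
have lv : 0 <= l v by apply: lp; rewrite mem_head.
exists (c + n * `|l v|)%N.
rewrite -[LHS](subrK ((v *+ p + x *~ l v) *+ n)) wE.
rewrite -{1}(gez0_abs lv) -pmulrn !mulrnDl !mulrnDr -!mulrnA !(mulnC n).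
by rewrite addrACA.
Qed.

(* If [l' x < 0], replace each other generator [v] by its multiple
   projected along [x] to the kernel of [l']. *)
Lemma farkas s b :
  (exists2 N, (0 < N)%N & ncone s (b *+ N)) \/
  exists l, {in s, forall v, 0 <= l v} /\ l b < 0.
Proof.
(* The induction is on the length, because the hypothesis is applied both to [s] and to the
   projected list. *)
have [n] := ubnP (size s); elim: n s b => // n IHn [|x s] b.
  move=> _ /=; case: (eqVneq b 0) => [->|]; first by left; exists 1%N.
  case/rV0Pn => j bj; right; have [l lE] := scalar_coord j (- b 0 j).
  exists l; split=> [v|]; first by rewrite in_nil.
  by rewrite lE mulNr oppr_lt0 -expr2 lt_def sqr_ge0 sqrf_eq0 bj.
rewrite ltnS => /= sn.
have [[N N0 bN]|[l' [l's l'b]]] := IHn s b sn.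
  by left; exists N => //; exists 0%N; rewrite mulr0n subr0.
have [l'x|l'x] := lerP 0 (l' x).
  right; exists l'; split=> // v; rewrite inE => /predU1P[->|] //.
  exact: l's.
pose p := `|l' x|%N; have pE : l' x = - p%:Z by rewrite /p ltz0_abs ?opprK.
have p0 : (0 < p)%N by rewrite absz_gt0 lt_eqF.
pose t (v : Zd) := v *+ p + x *~ l' v.
have szt : (size [seq t v | v <- s] < n)%N by rewrite size_map.
have [[N N0]|[l'' [l''s l''b]]] := IHn _ (t b) szt.
  case/(ncone_map l's) => u su [c uE]; left; exists (p * N)%N.
    by rewrite muln_gt0 p0.
  pose m := `|l' b|%N; have mE : l' b = - m%:Z by rewrite /m ltz0_abs ?opprK.
  (* Here [t b = b *+ p - x *+ m], so solving [t b *+ N = u *+ p + x *+ c] for [b *+ (p * N)] gives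
     this coefficient of [x]. *)
  exists (c + m * N)%N.
  suff -> : b *+ (p * N) - x *+ (c + m * N) = u *+ p by apply: nconeMn.
  rewrite -[RHS](addrK (x *+ c)) -uE /t mE mulrNz -pmulrn mulrnDl mulNrn.
  by rewrite mulrnDr opprD -!mulrnA -addrA [- _ - _]addrC.
(* This is [l''] composed with [t]; it vanishes at [x] since [l' x = - p]. *)
have [l lE] := scalar_comb l'' l' p%:Z (l'' x).
have ltE v : l v = l'' (t v).
  by rewrite lE /t raddfD raddfMn raddfMz -mulr_natl -mulrzr intz natz [l'' x * _]mulrC.
right; exists l; split=> [v|]; last by rewrite ltE.
rewrite inE => /predU1P[->|vs]; last by rewrite ltE l''s // map_f.
by rewrite lE pE; lia.
Qed.
End Farkas.

(** * Faces as submonoids with prime complement *)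

Section Faces.
Variables (d : nat) (Q : pmonoid d).
Local Notation Zd := 'rV[int]_d.

Lemma ncone_ind (C : Zd -> Prop) (s : seq Zd) v :
    C 0 -> (forall u w, C u -> C w -> C (u + w)) ->
    (forall x, x \in s -> C x) -> ncone s v -> C v.
Proof.
move=> C0 CD; elim: s v => [|x s IHs] v /= Cs; first by move->.
case=> n /IHs Cv; rewrite -[v](subrK (x *+ n)); apply: (CD).
  by apply: Cv => y ys; apply: Cs; rewrite inE ys orbT.
elim: n {Cv} => [|n IHn]; first by rewrite mulr0n.
by rewrite mulrS; apply: CD => //; apply: Cs; rewrite mem_head.
Qed.

(** Farkas separates each generator outside [P] from the cone spanned by all generators and the
    negatives of those in [P]; the negatives force vanishing there. Adding the resulting functionals
    exposes [P]. *)
Lemma prime_complement_face (P : {pred Zd}) :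
    affine_monoid Q -> 0 \in P -> {subset P <= Q} ->
    {in Q &, forall a b, (a + b \in P) = (a \in P) && (b \in P)} ->
  exists l : {scalar Zd}, {in Q, forall a, 0 <= l a} /\
    forall a, (a \in P) = (a \in Q) && (l a == 0).
Proof.
case=> n [g gQ] P0 PQ PD.
have gP i : g i \in Q.
  apply/gQ; exists (fun j => nat_of_bool (j == i)).
  by rewrite (bigD1 i) //= eqxx big1 ?addr0 // => j /negPf ->.
have PMn a m : a \in Q -> (0 < m)%N -> (a *+ m \in P) = (a \in P).
  move=> aQ; case: m => // m _; elim: m => [|m IHm]; first by rewrite mulr1n.
  by rewrite mulrS PD // ?rpredMn // IHm andbb.
have sep i : g i \notin P -> exists l : {scalar Zd}, [/\ forall j, 0 <= l (g j),
    forall j, g j \in P -> l (g j) = 0 & 0 < l (g i)].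
  move=> giP; pose s := [seq g j | j <- enum 'I_n] ++
    [seq - g j | j <- [seq j <- enum 'I_n | g j \in P]].
  have [[N N0 sN]|[l [ls lg]]] := farkas s (- g i).
    (* If [- g i *+ N] were in the cone, [g i *+ N + q] would lie in [P], and hence [g i] too. *)
    suff [q qQ [f fP gE]] : exists2 q, q \in Q & exists2 f, f \in P & - g i *+ N = q - f.
      have fE : f = g i *+ N + q.
        by apply: oppr_inj; rewrite opprD -mulNrn gE addrAC subrr add0r.
      by move: fP; rewrite fE PD ?rpredMn // PMn // (negPf giP).
    apply: (ncone_ind (C := fun v =>
      exists2 q, q \in Q & exists2 f, f \in P & v = q - f)) sN.
    - by exists 0; rewrite ?rpred0 //; exists 0; rewrite ?subr0.
    - move=> _ _ [q1 q1Q [f1 f1P ->]] [q2 q2Q [f2 f2P ->]].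
      exists (q1 + q2); first exact: rpredD.
      exists (f1 + f2); first by rewrite PD ?PQ // f1P.
      by rewrite opprD addrACA.
    - move=> x; rewrite mem_cat => /orP[] /mapP[j].
        by move=> _ ->; exists (g j) => //; exists 0; rewrite ?subr0.
      rewrite mem_filter => /andP[gjP _] ->; exists 0; first exact: rpred0.
      by exists (g j); rewrite ?sub0r.
  have lg0 j : 0 <= l (g j) by apply: ls; rewrite mem_cat map_f ?mem_enum.
  exists l; split=> // [j gjP|]; last by move: lg; rewrite raddfN oppr_lt0.
  apply/eqP; rewrite eq_le lg0 andbT -oppr_ge0 -raddfN; apply: ls.
  by rewrite mem_cat orbC (map_f (fun j => - g j)) // mem_filter gjP mem_enum.
have [l [l0 lP lnP]] : exists l : {scalar Zd}, [/\ forall j, 0 <= l (g j),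
    forall j, g j \in P -> l (g j) = 0 & forall j, g j \notin P -> 0 < l (g j)].
  suff [l [l0 lP lnP]] : exists l : {scalar Zd}, [/\ forall j, 0 <= l (g j),
      forall j, g j \in P -> l (g j) = 0 &
      forall j, j \in enum 'I_n -> g j \notin P -> 0 < l (g j)].
    by exists l; split=> // j; apply: lnP; rewrite mem_enum.
  elim: (enum 'I_n) => [|i r [l [l0 lP lnP]]].
    by exists [the {scalar _} of \0].
  have [giP|giP] := boolP (g i \in P).
    exists l; split=> // j; rewrite inE => /predU1P[->|]; last exact: lnP.
    by rewrite giP.
  have [l' [l'0 l'P l'nP]] := sep i giP.
  have [l2 l2E] := scalar_comb l l' 1 1; exists l2; split=> j.
  - by rewrite l2E !mul1r addr_ge0.
  - by move=> gjP; rewrite l2E !mul1r lP // l'P.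
  - rewrite l2E !mul1r inE => /predU1P[->|jr] gjP; first exact: ltr_wpDl.
    by rewrite ltr_pwDl // lnP.
have lS c : l (\sum_i g i *+ c i) = \sum_i l (g i) *+ c i.
  by rewrite raddf_sum; apply: eq_bigr => i _; apply: raddfMn.
exists l; split=> [a|a].
  case/gQ => c ->; rewrite lS; apply: sumr_ge0 => i _.
  by rewrite mulrn_wge0.
apply/idP/andP => [aP|[/gQ[c ->]]].
  have aQ := PQ a aP; split=> //; have [c aE] := (gQ a).1 aQ; apply/eqP.
  rewrite aE lS big1 // => i _.
  case: (posnP (c i)) => [->|ci]; first by rewrite mulr0n.
  rewrite lP ?mul0rn // -(PMn _ (c i)) //.
  move: aP; rewrite aE (bigD1 i) //= PD ?rpredMn ?rpred_sum //.
    by case/andP.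
  by move=> j _; rewrite rpredMn.
rewrite lS psumr_eq0 => [/allP lc|i _]; last first.
  by rewrite mulrn_wge0.
suff: (\sum_i g i *+ c i \in Q) && (\sum_i g i *+ c i \in P) by case/andP.
elim/big_ind: _ => [|x y /andP[xQ xP] /andP[yQ yP]|i _].
- by rewrite rpred0.
- by rewrite rpredD // PD // xP.
rewrite rpredMn //=; case: (posnP (c i)) => [->|ci]; first by rewrite mulr0n.
rewrite PMn //; have := lc i (mem_index_enum i); rewrite mulrn_eq0.
rewrite -[c i == 0%N]negbK -lt0n ci /=.
by apply: contraLR => /lnP; rewrite lt_def => /andP[].
Qed.
End Faces.

(** * Monomial ideals and irreducibility *)

Section Monomials.
Variables (k : fieldType) (d : nat) (Q : pmonoid d).
Local Notation kQ := {malg k[elt Q]}.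
Implicit Types (W V : monideal k Q) (a b c q r : elt Q).

Lemma monomM a b : << a >> * << b >> = << mmul a b >> :> kQ.
Proof. by rewrite malgM_def fgmulUU mulr1. Qed.

Lemma monom_scale_mem W (x : k) a :
  (<< x *g a >> \in W) = (x == 0) || (<< a >> \in W).
Proof.
have [->|x0 /=] := eqVneq x 0; first by rewrite monalgU0 rpred0.
apply/idP/idP => [xa|aW]; last by rewrite monom_scale; apply: idealM.
have -> : << a >> = x^-1%:MP * << x *g a >> :> kQ.
  by rewrite (monom_scale x) mulrA -mpolyCM mulVf // mul1r.
exact: idealM.
Qed.

Lemma monom_notin W f : f \notin W -> exists2 a, a \in msupp f & << a >> \notin W.
Proof.
move=> fW; apply: NNPP => no; case/negP: fW; rewrite [f]monalgE big_seq.
apply: rpred_sum => a af; rewrite monom_scale_mem orbC.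
by case: (boolP (_ \in _)) => // aW; case: no; exists a.
Qed.

Lemma monomM_mem W a b : << a >> \in W -> << mmul b a >> \in W.
Proof. by move=> aW; rewrite -monomM; apply: idealM. Qed.

Section AddMonomial.
Variables (W : monideal k Q) (a : elt Q).

(** The ideal [W + (x^a)], tested on supports: [eval b - eval a \in Q] means that [x^a] divides
    [x^b]. *)
Definition add_monom_pred : {pred kQ} := fun f =>
  all (fun b : elt Q => (<< b >> \in W) || (eval b - eval a \in Q)) (msupp f).

Fact add_monom_zmod : zmod_closed add_monom_pred.
Proof.
split=> [|f g /allP fP /allP gP]; first by apply/allP => b; rewrite msupp0 in_fset0.
apply/allP => b /(fsubsetP (msuppB_le _ _)); rewrite in_fsetU.
by case/orP; [apply: fP | apply: gP].
Qed.
HB.instance Definition _ := GRing.isZmodClosed.Build kQ add_monom_pred add_monom_zmod.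

Fact add_monomM (h : kQ) : {in add_monom_pred, forall f, h * f \in add_monom_pred}.
Proof.
move=> f /allP fP; apply/allP => b /msuppM_le[b1 [b2 [_ /fP b2P ->]]] /=.
case/orP: b2P => [b2W|b2a]; first by rewrite monomM_mem.
by rewrite -addrA rpredD ?eltP ?orbT.
Qed.

Definition add_monom : ideal kQ := Ideal add_monomM.

Lemma add_monomP f : reflect
  (forall b : elt Q, b \in msupp f -> (<< b >> \in W) || (eval b - eval a \in Q))
  (f \in add_monom).
Proof. exact: allP. Qed.

Lemma add_monom_proper : << a >> \notin W -> properly_contains add_monom W.
Proof.
move=> aW; split=> [f fW|sub].
  by apply/add_monomP => b bf; rewrite (monidealP fW).
case/negP: aW; apply: sub; apply/add_monomP => b /(fsubsetP msuppU_le).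
by rewrite in_fset1 => /eqP ->; rewrite subrr rpred0 orbT.
Qed.

End AddMonomial.

(** Otherwise [W] would be the intersection of [W + (x^a)] and [W + (x^b)]. Later arguments exploit
    irreducibility only in this form. *)
Lemma irreducible_directed W a b : irreducible W ->
    << a >> \notin W -> << b >> \notin W ->
  exists q r, mmul q a = mmul r b /\ << mmul q a >> \notin W.
Proof.
move=> irrW aW bW; apply: NNPP => no; apply: irrW.
exists (add_monom W a), (add_monom W b); split; try exact: add_monom_proper.
move=> f; apply/idP/andP => [fW|[/add_monomP fa /add_monomP fb]].
  by split; apply/add_monomP => c cf; rewrite (monidealP fW).
apply/negPn/negP => /monom_notin[c cf cW].
have /orP[/(negP cW) //|ca] := fa c cf.
have /orP[/(negP cW) //|cb] := fb c cf.
have cE : c = mmul (Elt ca) a by apply: val_inj; rewrite /= subrK.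
apply: no; exists (Elt ca), (Elt cb); rewrite -cE; split=> //.
by apply: val_inj; rewrite /= subrK.
Qed.

Lemma homogE a (f : kQ) : homog (eval a) f -> f = << f@_a *g a >>.
Proof.
move=> fa; apply/malgP => b; rewrite mcoeffU.
have [<-|ab] := eqVneq a b; first by rewrite mulr1n.
rewrite mulr0n; apply/eqP; rewrite mcoeff_eq0; apply: contra ab => /fa ba.
by apply/eqP/val_inj.
Qed.

Lemma homogU a (x : k) : homog (eval a) << x *g a >>.
Proof. by move=> b /(fsubsetP msuppU_le); rewrite in_fset1 => /eqP ->. Qed.

Lemma pi_eq0 W f : pi W f = 0 <-> f \in W.
Proof. by rewrite -(pi0 W) pi_eq subr0. Qed.

Lemma gquot_compE W a (v : gquot W) :
  gcomp (eval a) v -> exists x : k, v = pi W << x *g a >>.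
Proof. by case=> f /homogE -> ->; exists f@_a. Qed.

Lemma gquot_compU W a (x : k) :
  gcomp (g := gquot W) (eval a) (pi W << x *g a >>).
Proof. by exists << x *g a >> => //; apply: homogU. Qed.

Lemma gcompZ1 (M : gmodule k Q) a q (v : M) :
  gcomp (eval a) v -> gcomp (eval (mmul q a)) (<< q >> *: v).
Proof. exact: gcompZ. Qed.

End Monomials.

(** * Graded homomorphisms and direct sums *)

Section Homs.
Variables (k : fieldType) (d : nat) (Q : pmonoid d).
Local Notation gmodule := (gmodule k Q).
Local Notation monideal := (monideal k Q).
Implicit Types (L M N : gmodule) (W V : monideal).

Lemma mk_ghom M N (f : M -> N) : linear f ->
    (forall a v, gcomp a v -> gcomp a (f v)) ->
  exists g : ghom M N, forall v, g v = f v.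
Proof.
move=> lin fP; pose L := GRing.isLinear.Build _ _ _ _ _ lin.
pose g : {linear M -> N} := HB.pack f L.
by exists (GHom (ghom_fun := g) fP).
Qed.

Lemma ghom0 M N : exists g : ghom M N, forall v, g v = 0.
Proof.
apply: mk_ghom => [x u v|a v _]; last exact: gcomp0.
by rewrite scaler0 addr0.
Qed.

Lemma ghom_comp L M N (f : ghom L M) (g : ghom M N) :
  exists h : ghom L N, forall v, h v = g (f v).
Proof.
apply: mk_ghom => [x u v|a v va]; first by rewrite !linearP.
by do 2!apply: ghomP.
Qed.

Lemma ghom_sub M N (f g : ghom M N) : exists h : ghom M N, forall v, h v = f v - g v.
Proof.
apply: mk_ghom => [x u v|a v va]; last by apply: gcompB; apply: ghomP.
by rewrite scalerBr addrACA -opprD !linearP.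
Qed.

Lemma ghom_scale M N (x : k) (f : ghom M N) :
  exists h : ghom M N, forall v, h v = x%:MP *: f v.
Proof.
apply: mk_ghom => [y u v|a v va].
  by rewrite linearP scalerDr !scalerA mulrC.
by rewrite -[a]add0r; apply: (gcompZ x (elt0 Q)); apply: ghomP.
Qed.

Section DirectSum.
Variables (n : nat) (T : 'I_n -> gmodule).

Lemma ghom_proj j : exists g : ghom (gdsum T) (T j), forall v, g v = dsum_coord v j.
Proof.
apply: mk_ghom => [x u v|a v va]; last exact: va.
by rewrite dsum_coordD dsum_coordZ.
Qed.

Definition dsum_inj j (v : T j) : gdsum T := dsum_mk (dfwith (fun i => 0 : T i) v).

Lemma dsum_injK j v : dsum_coord (@dsum_inj j v) j = v.
Proof. by rewrite dsumE dfwith_in. Qed.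

Lemma dsum_inj_out j v i : j != i -> dsum_coord (@dsum_inj j v) i = 0.
Proof. by move=> ij; rewrite dsumE dfwith_out. Qed.

Lemma ghom_inj j : exists g : ghom (T j) (gdsum T), forall v, g v = dsum_inj v.
Proof.
apply: mk_ghom => [x u v|a v va].
  apply: dsumP => i; rewrite dsum_coordD dsum_coordZ.
  case: (eqVneq j i) => [<-|ji]; first by rewrite !dsum_injK.
  by rewrite !dsum_inj_out // scaler0 addr0.
move=> i; case: (eqVneq j i) => [<-|ji]; first by rewrite dsum_injK.
by rewrite dsum_inj_out //; apply: gcomp0.
Qed.

Lemma ghom_pair M (f : forall j, ghom M (T j)) :
  exists g : ghom M (gdsum T), forall v j, dsum_coord (g v) j = f j v.
Proof.
have [||g gE] := @mk_ghom M (gdsum T) (fun v => dsum_mk (fun j => f j v)).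
- move=> x u v; apply: dsumP => j.
  by rewrite dsum_coordD dsum_coordZ !dsumE linearP.
- by move=> a v va j; rewrite dsumE; apply: ghomP.
by exists g => v j; rewrite gE dsumE.
Qed.

End DirectSum.

Section QuotMap.
Variables (W V : monideal) (WV : {subset W <= V}).

Lemma ghom_quot : exists g : ghom (gquot W) (gquot V), forall f, g (pi W f) = pi V f.
Proof.
have reprE f : pi V (repr (pi W f)) = pi V f.
  by apply/pi_eq/WV/pi_eq; rewrite /pi reprK.
have [||g gE] := @mk_ghom (gquot W) (gquot V) (fun v => pi V (repr v)).
- move=> x u v; have [f ->] := pi_surj u; have [h ->] := pi_surj v.
  by rewrite pi_scale -piD (reprE (x * f + h)) (reprE f) (reprE h) piD pi_scale.
- by move=> a _ [f fa ->]; exists f => //; rewrite reprE.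
by exists g => f; rewrite gE reprE.
Qed.

End QuotMap.

Lemma giso_quot W V : {subset W <= V} -> {subset V <= W} -> giso (gquot W) (gquot V).
Proof.
move=> /ghom_quot[f fE] /ghom_quot[g gE]; exists f, g.
by split=> v; have [h ->] := pi_surj v; rewrite (fE, gE) (fE, gE).
Qed.

(** Serves to enlarge a term of a resolution by one summand. Describing the larger sum by its two
    projections hides the reindexing from later arguments. *)
Lemma gdsum_snoc n (V : 'I_n -> monideal) W :
    (forall j, irreducible (V j)) -> irreducible W ->
  exists (V' : 'I_n.+1 -> monideal)
    (p : ghom (gdsum (fun j => gquot (V' j))) (gdsum (fun j => gquot (V j))))
    (p0 : ghom (gdsum (fun j => gquot (V' j))) (gquot W)),
  [/\ forall j, irreducible (V' j),
      forall v v', p v = p v' -> p0 v = p0 v' -> v = v' &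
      forall M (h : ghom M (gdsum (fun j => gquot (V j)))) (r : ghom M (gquot W)),
        exists h' : ghom M (gdsum (fun j => gquot (V' j))),
          (forall u, p (h' u) = h u) /\ (forall u, p0 (h' u) = r u)].
Proof.
(* [V' (lift ord0 i)] and [V i] are equal but not convertible, so [ghom_quot] takes the place of a
   cast. *)
move=> irrV irrW; pose V' j := if unlift ord0 j is Some i then V i else W.
have VE i : V' (lift ord0 i) = V i by rewrite /V' liftK.
have WE : V' ord0 = W by rewrite /V' unlift_none.
have /fin_all_exists [p_ p_E] i :
    exists g : ghom (gquot (V' (lift ord0 i))) (gquot (V i)),
    forall f, g (pi _ f) = pi _ f by apply: ghom_quot; rewrite VE.
have [p0_ p0_E] : exists g : ghom (gquot (V' ord0)) (gquot W),
    forall f, g (pi _ f) = pi _ f by apply: ghom_quot; rewrite WE.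
have /fin_all_exists[pr prE] j :
    exists g : ghom (gdsum (fun j => gquot (V' j))) (gquot (V' j)),
    forall v, g v = dsum_coord v j by apply: ghom_proj.
have /fin_all_exists [pi_ pi_E] i :
    exists g : ghom (gdsum (fun j => gquot (V' j))) (gquot (V i)),
    forall v, g v = p_ i (pr (lift ord0 i) v) by apply: ghom_comp.
have [p pE] := ghom_pair pi_.
have [p0 p0E] := ghom_comp (pr ord0) p0_.
have p_inj i v v' : p_ i v = p_ i v' -> v = v'.
  have [f ->] := pi_surj v; have [f' ->] := pi_surj v'.
  by rewrite !p_E !pi_eq VE.
have p0_inj v v' : p0_ v = p0_ v' -> v = v'.
  have [f ->] := pi_surj v; have [f' ->] := pi_surj v'.
  by rewrite !p0_E !pi_eq WE.
exists V', p, p0; split=> [j|v v' pv p0v|M h r].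
- by case: (unliftP ord0 j) => [i|] ->; rewrite ?VE ?WE.
- apply: dsumP => j; rewrite -!prE.
  case: (unliftP ord0 j) => [i|] ->; last by apply: p0_inj; rewrite -!p0E.
  by apply: p_inj; rewrite -!pi_E -!pE pv.
(* Specifying components by common representatives at a variable index [j] avoids transport along
   [j = lift ord0 i]. *)
have /fin_all_exists [h_ h_E] j : exists c : ghom M (gquot (V' j)),
    (forall i u, j = lift ord0 i -> exists2 f,
      dsum_coord (h u) i = pi (V i) f & c u = pi (V' j) f) /\
    (forall u, j = ord0 -> exists2 f, r u = pi W f & c u = pi (V' j) f).
  case: (unliftP ord0 j) => [i|] ->.
    have [g gE] : exists g : ghom (gquot (V i)) (gquot (V' (lift ord0 i))),
        forall f, g (pi _ f) = pi _ f by apply: ghom_quot; rewrite VE.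
    have [pri priE] := ghom_proj (fun j => gquot (V j)) i.
    have [h1 h1E] := ghom_comp h pri; have [h2 h2E] := ghom_comp h1 g.
    exists h2; split=> // i' u /lift_inj <-.
    have [f fE] := pi_surj (dsum_coord (h u) i); exists f => //.
    by rewrite h2E h1E priE fE gE.
  have [g gE] : exists g : ghom (gquot W) (gquot (V' ord0)),
      forall f, g (pi _ f) = pi _ f by apply: ghom_quot; rewrite WE.
  have [h2 h2E] := ghom_comp r g; exists h2; split=> // u _.
  by have [f fE] := pi_surj (r u); exists f => //; rewrite h2E fE gE.
have [h' h'E] := ghom_pair h_; exists h'; split=> u.
  apply: dsumP => i; rewrite pE pi_E prE h'E.
  by have [f -> ->] := (h_E (lift ord0 i)).1 i u erefl; rewrite p_E.
by rewrite p0E prE h'E; have [f -> ->] := (h_E ord0).2 u erefl; rewrite p0_E.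
Qed.
End Homs.

(** * Maps from an irreducible quotient *)

Section Resolutions.
Variables (k : fieldType) (d : nat) (Q : pmonoid d).
Local Notation kQ := {malg k[elt Q]}.
Local Notation monideal := (monideal k Q).
Local Notation qsum V := (gdsum (fun j => gquot (V j))).

(* Everything is determined by the degree-zero scalars [phi 1 = (x_j)_j]: either
   some [x_j != 0] with [V j = W], or a common multiple outside [W] of monomials
   in the remaining [V j] is killed. *)
Lemma kills_monomial_or_splits n (V : 'I_n -> monideal) (W : monideal)
    (phi : ghom (gquot W) (qsum V)) :
    irreducible W ->
  (exists2 c : elt Q, << c >> \notin W & phi (pi W << c >>) = 0) \/
  exists r : ghom (qsum V) (gquot W), forall e, r (phi e) = e.
Proof.
move=> irrW; pose e0 := elt0 Q.
have piE f : pi W f = f *: (pi W << e0 >> : gquot W) by rewrite pi_scale mulr1.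
have /fin_all_exists[x xE] j : exists x : k,
    dsum_coord (phi (pi W << e0 >>)) j = pi (V j) x%:MP.
  by apply: gquot_compE; apply: (ghomP phi (gquot_compU W e0 1) j).
have phiE f j : dsum_coord (phi (pi W f)) j = pi (V j) (f * (x j)%:MP).
  by rewrite piE linearZ dsum_coordZ xE pi_scale.
(* For the unit ideal the quotient is zero, and the zero map is a retraction. *)
have [W1|/negP W1] := classic ((<< e0 >> : kQ) \in W).
  right. have [r r0] := ghom0 (qsum V) (gquot W); exists r => e.
  rewrite r0. have [f ->] := pi_surj e. apply: esym. apply/pi_eq0.
  have := idealM f W1. rewrite mulr1. by [].
have [[j [xj VW]]|noj] := classic (exists j, x j != 0 /\ {subset V j <= W}).
  (* The retraction projects to coordinate [j], passes to [k[Q]/W] and divides by [x j]. *)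
  right; have [p pE] := ghom_proj (fun j => gquot (V j)) j.
  have [g gE] := ghom_quot VW; have [pg pgE] := ghom_comp p g.
  have [r rE] := ghom_scale (x j)^-1 pg; exists r => e.
  have [f ->] := pi_surj e; rewrite rE pgE pE phiE gE pi_scale.
  have -> : (x j)^-1%:MP * (f * (x j)%:MP) = f * ((x j)^-1%:MP * (x j)%:MP).
    by rewrite mulrCA.
  by rewrite -mpolyCM (mulVf xj) mpolyC1E mulr1.
have [c cW cj] : exists2 c : elt Q, << c >> \notin W &
    forall j, j \in enum 'I_n -> << c >> *: (pi (V j) (x j)%:MP : gquot (V j)) = 0.
  elim: (enum 'I_n) => [|j s [c cW cs]]; first by exists e0.
  have [xj|xj] := eqVneq (x j) 0.
    exists c => // i; rewrite inE => /predU1P[->|]; last exact: cs.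
    by rewrite xj monalgU0 pi0 scaler0.
  (* Since [x j] is nonzero, [V j] has a monomial outside [W]; a common multiple with [c] kills this
     coordinate as well. *)
  have [f fV fW] : exists2 f, f \in V j & f \notin W.
    apply: NNPP => no; apply: noj; exists j; split=> // f fV.
    by apply/negPn/negP => fW; apply: no; exists f.
  have [a af aW] := monom_notin fW; have aV := monidealP fV af.
  have [q [r [qr qaW]]] := irreducible_directed irrW aW cW.
  exists (mmul q a) => // i; rewrite inE => /predU1P[->|/cs ci].
    rewrite pi_scale; apply/pi_eq0; rewrite mulrC; apply: idealM.
    exact: monomM_mem.
  by rewrite qr -(monomM k r c) -scalerA; apply: etrans (congr1 _ ci) (scaler0 _ _).
left; exists c => //; apply: dsumP => j.
by rewrite phiE dsum_coord0 -(cj j (mem_enum _ j)) pi_scale.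
Qed.
End Resolutions.

(** * Splicing resolutions *)

Section Tails.
Variables (k : fieldType) (d : nat) (Q : pmonoid d).
Local Notation gmodule := (gmodule k Q).
Local Notation monideal := (monideal k Q).
Local Notation qsum V := (gdsum (fun j => gquot (V j))).

(* An exact sequence [0 -> K -> A -> term 0 -> term 1 -> ...]: an irreducible
   resolution of [A / K] that avoids forming this quotient. *)
Record tail (A : gmodule) (K : A -> Prop) := Tail {
  tmu : nat -> nat;
  tideal : forall i, 'I_(tmu i) -> monideal;
  tterm i : gmodule := qsum (@tideal i);
  thead : ghom A (tterm 0);
  tdiff : forall i, ghom (tterm i) (tterm i.+1);
  tirr : forall i j, irreducible (@tideal i j);
  thead_ker : forall v, thead v = 0 <-> K v;
  texact0 : forall v, tdiff 0 v = 0 <-> exists u, v = thead u;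
  texactS : forall i v, tdiff i.+1 v = 0 <-> exists u, v = tdiff i u
}.

Lemma tail_ext (A : gmodule) (K K' : A -> Prop) (t : tail K) : (forall v, K v <-> K' v) ->
  exists t' : tail K', tmu t' =1 tmu t.
Proof.
move=> KK'; have hk v : thead t v = 0 <-> K' v.
  by split=> [/thead_ker/KK'|/KK'/thead_ker].
by exists (Tail (@tirr _ _ t) hk (@texact0 _ _ t) (@texactS _ _ t)).
Qed.

Lemma tail_comp (A B : gmodule) (K : B -> Prop) (f : ghom A B) (t : tail K) :
  (forall v, exists u, f u = v) ->
  exists t' : tail (fun u => K (f u)), tmu t' =1 tmu t.
Proof.
move=> f_surj; have [h hE] := ghom_comp f (thead t).
have hk v : h v = 0 <-> K (f v) by rewrite hE; apply: thead_ker.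
have ex0 v : tdiff t 0 v = 0 <-> exists u, v = h u.
  split=> [/texact0[w ->]|[u ->]]; last by apply/texact0; exists (f u).
  by have [u <-] := f_surj w; exists u.
by exists (Tail (@tirr _ _ t) hk ex0 (@texactS _ _ t)).
Qed.

Section Cons.
Variables (A : gmodule) (m : nat) (W : 'I_m -> monideal) (f : ghom A (qsum W)).
Variables (irrW : forall j, irreducible (W j)).
Variable t : tail (fun v : qsum W => exists u, v = f u).

Let mu' i := if i is i'.+1 then tmu t i' else m.
Let ideal' i : 'I_(mu' i) -> monideal :=
  match i with 0 => W | i'.+1 => @tideal _ _ t i' end.
Let term' i := qsum (@ideal' i).
Let diff' i : ghom (term' i) (term' i.+1) :=
  match i with 0 => thead t | i'.+1 => tdiff t i' end.

(** Exactness at the new joint holds because the kernel of the old head is the image of [f]. The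
    proof ends in [Defined] because [tmu] has to compute. *)
Definition tail_cons : tail (fun v => f v = 0).
Proof.
refine (@Tail A _ mu' ideal' f diff' _ _ _ _) => //.
- by case=> [|i] j; [apply: irrW | apply: tirr].
- by move=> v; apply: thead_ker.
- by case=> [|i] v; [apply: texact0 | apply: texactS].
Defined.

End Cons.

Variables (M : gmodule) (R : irr_resolution M).

(** [M] counts as the term of index -1, so that exactness takes one form at all indices. *)
Definition prior n : gmodule := if n is n'.+1 then term R n' else M.
Definition prior_map n : ghom (prior n) (term R n) :=
  match n with 0 => augmentation R | n'.+1 => differential R n' end.

Lemma exact_prior n v : differential R n v = 0 <-> exists u, v = prior_map n u.
Proof. by case: n v => [|n] v; [apply: exact_term0 | apply: exact_termS]. Qed.

Definition resolution_tail n : tail (fun v : term R n => exists u, v = prior_map n u).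
Proof.
(* Addition recurses on its first argument, so [0 + n.+1] and [i.+1 + n.+1] reduce to the indices
   that [differential] expects. *)
refine (@Tail (term R n) _ (fun i => mu R (i + n.+1))
  (fun i => @irr_ideal _ _ _ _ R (i + n.+1))
  (differential R n) (fun i => differential R (i + n.+1)) _ _ _ _).
- by move=> i j; apply: irr_idealP.
- exact: exact_prior.
- by move=> v; apply: exact_termS.
- by move=> i v; apply: exact_termS.
Defined.

(** The terms of [R] before index [n] are spliced back in front of [t] one at a time; at the end,
    injectivity of the augmentation makes the head injective. *)
Lemma resolution_of_tail n i (t : tail (fun v => prior_map n v = 0)) :
  exists R' : irr_resolution M, mu R' (n + i)%N = tmu t i.
Proof.
elim: n i t => [|n IHn] i t.
  have inj : injective (thead t).
    apply: raddf_inj => v /thead_ker v0; apply: (@augmentation_inj _ _ _ _ R).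
    by rewrite [LHS]v0 raddf0.
  by exists (IrrResolution (@tirr _ _ t) inj (@texact0 _ _ t) (@texactS _ _ t)).
have [t' t'E] := tail_ext t (@exact_prior n).
have [R' R'E] := IHn i.+1 (tail_cons (@irr_idealP _ _ _ _ R n) t').
by exists R'; rewrite addSnnS R'E /= t'E.
Qed.

End Tails.

(** * Cancelling a split summand *)

Section Cancel.
Variables (k : fieldType) (d : nat) (Q : pmonoid d).
Local Notation gmodule := (gmodule k Q).
Local Notation monideal := (monideal k Q).
Local Notation qsum V := (gdsum (fun j => gquot (V j))).

Lemma dsum_remove n (T : 'I_n -> gmodule) (j0 : 'I_n) :
  exists (p : ghom (gdsum T) (gdsum (fun j => T (lift j0 j))))
         (s : ghom (gdsum (fun j => T (lift j0 j))) (gdsum T)),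
  [/\ forall u, p (s u) = u, forall e, p (dsum_inj (T := T) (j := j0) e) = 0 &
      forall v, v = s (p v) + dsum_inj (T := T) (dsum_coord v j0)].
Proof.
have [p pE] : exists p : ghom (gdsum T) (gdsum (fun j => T (lift j0 j))),
    forall v j, dsum_coord (p v) j = dsum_coord v (lift j0 j).
  have /fin_all_exists[pr prE] j : exists g : ghom (gdsum T) (T (lift j0 j)),
    forall v, g v = dsum_coord v (lift j0 j) by apply: ghom_proj.
  by have [p pE] := ghom_pair pr; exists p => v j; rewrite pE prE.
have [s [sE s0]] : exists s : ghom (gdsum (fun j => T (lift j0 j))) (gdsum T),
    (forall u j, dsum_coord (s u) (lift j0 j) = dsum_coord u j) /\
    (forall u, dsum_coord (s u) j0 = 0).
  have /fin_all_exists[g gE] i :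
      exists g : ghom (gdsum (fun j => T (lift j0 j))) (T i),
      (forall j u, i = lift j0 j -> exists e : forall l, T l,
         dsum_coord u j = e (lift j0 j) /\ g u = e i) /\
      (i = j0 -> forall u, g u = 0).
    case: (unliftP j0 i) => [j|] ->.
      have [g gE] := ghom_proj (fun j => T (lift j0 j)) j.
      exists g; split=> [j' u /lift_inj <-|]; last first.
        by move/eqP; rewrite eq_sym (negPf (neq_lift _ _)).
      exists (dfwith (fun l => 0 : T l) (dsum_coord u j)).
      by rewrite dfwith_in gE.
    have [g gE] := ghom0 (gdsum (fun j => T (lift j0 j))) (T j0).
    by exists g; split=> // j u /eqP; rewrite (negPf (neq_lift _ _)).
  have [s sE] := ghom_pair g; exists s; split=> [u j|u]; rewrite sE.
    by have [e [-> ->]] := (gE (lift j0 j)).1 j u erefl.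
  by rewrite (gE j0).2.
exists p, s; split=> [u|e|v]; apply: dsumP => j.
- by rewrite pE sE.
- by rewrite pE dsum_inj_out ?neq_lift // dsum_coord0.
- rewrite dsum_coordD; case: (unliftP j0 j) => [i|] ->.
    by rewrite sE pE dsum_inj_out ?neq_lift // addr0.
  by rewrite s0 dsum_injK add0r.
Qed.

(* Dropping the summand [j0] of the first term is compensated by a copy of it in
   the third one, onto which the second term maps by the retraction [r]. *)
Lemma cancel_summand (A : gmodule) m n1 n2 (W : 'I_m -> monideal)
    (V1 : 'I_n1 -> monideal) (V2 : 'I_n2 -> monideal)
    (f : ghom A (qsum W)) (g : ghom (qsum W) (qsum V1))
    (h : ghom (qsum V1) (qsum V2)) (t : tail (fun v : qsum V2 => exists u, v = h u))
    (j0 : 'I_m) (r : ghom (qsum V1) (gquot (W j0))) :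
    (forall j, irreducible (W j)) -> (forall j, irreducible (V1 j)) ->
    (forall j, irreducible (V2 j)) ->
    (forall v, g v = 0 <-> exists u, v = f u) ->
    (forall v, h v = 0 <-> exists u, v = g u) ->
    (forall e, r (g (dsum_inj (T := fun j => gquot (W j)) e)) = e) ->
  exists t' : tail (fun v => f v = 0), tmu t' 0 = m.-1.
Proof.
move=> irrW irrV1 irrV2 exg exh rK.
have [p [s [sK p0 decomp]]] := dsum_remove (fun j => gquot (W j)) j0.
have [inj injE] := ghom_inj (fun j => gquot (W j)) j0.
have {}rK e : r (g (inj e)) = e by rewrite injE rK.
have {}p0 e : p (inj e) = 0 by rewrite injE p0.
have {}decomp v : exists e, v = s (p v) + inj e.
  by exists (dsum_coord v j0); rewrite injE; apply: decomp.
have [f' f'E] := ghom_comp f p.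
have [g1 g1E] := ghom_comp s g.
have [g2 g2E] := ghom_comp g1 r.
have [g3 g3E] := ghom_comp g2 inj.
have [g4 g4E] := ghom_comp g3 g.
(* The correction makes [r] vanish on the image of [g'], as needed for exactness once [h] is
   replaced by the pair [(h, r)]. *)
have [g' g'sub] := ghom_sub g1 g4.
have g'E u : g' u = g (s u - inj (r (g (s u)))).
  by rewrite g'sub g4E g3E g2E g1E linearB.
have rg' u : r (g' u) = 0 by rewrite g'E !linearB rK subrr.
(* If [p (f v) = 0], then [f v = inj e] is killed by [g], and applying [r] gives [e = 0]. *)
have kerf' v : f' v = 0 <-> f v = 0.
  rewrite f'E; split=> [pf|->]; last exact: linear0.
  have [e fE] := decomp (f v); move: fE; rewrite pf linear0 add0r => fE.
  have: g (f v) = 0 by apply/exg; exists v.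
  by rewrite fE => /(congr1 r); rewrite rK linear0 => ->; rewrite linear0.
have kerg' u : g' u = 0 <-> exists v, u = f' v.
  rewrite g'E exg; split=> [[v vE]|[v ->]].
    by exists v; rewrite f'E -vE linearB sK p0 subr0.
  exists v; rewrite f'E; have [e fE] := decomp (f v).
  have gs : g (s (p (f v))) = - g (inj e).
    apply/eqP; rewrite -addr_eq0 -linearD -fE; apply/eqP/exg.
    by exists v.
  by rewrite gs linearN rK linearN opprK -fE.
have [V' [P [P0 [irrV' P_inj lift_hom]]]] := gdsum_snoc irrV2 (irrW j0).
have [h' [Ph' P0h']] := lift_hom _ h r.
have kerh' w : h' w = 0 <-> exists u, w = g' u.
  split=> [h'w|[u ->]].
    have hw : h w = 0 by rewrite -Ph' h'w linear0.
    have rw : r w = 0 by rewrite -P0h' h'w linear0.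
    have [v wE] := (exh w).1 hw; have [e vE] := decomp v.
    exists (p v); rewrite g'E wE; congr (g _); rewrite {1}vE; congr (_ + _).
    rewrite -linearN; congr (inj _); apply/eqP; rewrite -addr_eq0 addrC.
    by move: rw; rewrite wE {1}vE !linearD rK => ->.
  apply: P_inj; last by rewrite P0h' rg' linear0.
  by rewrite Ph' linear0; apply/exh; rewrite g'E; eexists.
have P_surj v : exists u, P u = v.
  have [i iE] := mk_ghom (f := fun v : qsum V2 => v)
    (fun _ _ _ => erefl) (fun _ _ w => w).
  have [z zE] := ghom0 (qsum V2) (gquot (W j0)).
  by have [l [Pl _]] := lift_hom _ i z; exists (l v); rewrite Pl iE.
have [t1 _] := tail_comp t P_surj.
have kerP v : (exists u, P v = h u) <-> exists u, v = h' u.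
  split=> [[u Pv]|[u ->]]; last by exists u; rewrite Ph'.
  (* The added element lies in the kernel of [h] and corrects the value of [r] from [r u] to
     [P0 v]. *)
  exists (u + g (inj (P0 v - r u))); apply: P_inj.
    rewrite Ph' linearD -Pv (_ : h (g _) = 0) ?addr0 //.
    by apply/exh; eexists.
  by rewrite P0h' linearD rK addrC subrK.
have [t2 _] := tail_ext t1 kerP.
have [t3 _] := tail_ext (tail_cons irrV' t2) kerh'.
have [t4 _] := tail_ext (tail_cons irrV1 t3) kerg'.
have [t6 t6E] := tail_ext (tail_cons (fun j => irrW (lift j0 j)) t4) kerf'.
by exists t6; rewrite t6E.
Qed.
End Cancel.

(** * Face-closedness along a minimal resolution *)

Section Support.
Variables (k : fieldType) (d : nat) (Q : pmonoid d).
Local Notation kQ := {malg k[elt Q]}.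
Local Notation Zd := 'rV[int]_d.
Local Notation gmodule := (gmodule k Q).
Local Notation monideal := (monideal k Q).
Local Notation qsum V := (gdsum (fun j => gquot (V j))).
(** The component of [u] in degree [a] serves, since [f] sends components to components and those of
    [f u] are unique. *)
Lemma homogeneous_preimage (M N : gmodule) (f : ghom M N) (a : Zd) u :
  gcomp a (f u) -> exists2 u', gcomp a u' & f u = f u'.
Proof.
move=> fua; have [s [w [wP uE]]] := gcomp_span u.
(* [w] may be nonzero outside [s], and [s] may miss [a]; extending by zero covers both cases. *)
pose w1 b := if b \in s then w b else 0.
have w1P b : gcomp b (w1 b) by rewrite /w1; case: ifP => _; [apply: wP | apply: gcomp0].
pose s' := (a |` s)%fset; have as' : a \in s' by rewrite in_fset1U eqxx.
have uE' : u = \sum_(b <- s') w1 b.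
  rewrite uE -(big_fset_incl _ (fsubsetU1 a s)) => [|b _ /negPf bs].
    by rewrite !big_seq; apply: eq_bigr => b bs; rewrite /w1 bs.
  by rewrite /w1 bs.
exists (w1 a) => //; apply/eqP; rewrite eq_sym -subr_eq0; apply/eqP.
pose z b := f (w1 b) - (if b == a then f u else 0).
have zP b : gcomp b (z b).
  apply: gcompB; first exact: ghomP.
  by case: eqP => [->|_] //; apply: gcomp0.
have -> : f (w1 a) - f u = z a by rewrite /z eqxx.
apply: (gcomp_indep zP) as'.
rewrite sumrB -linear_sum -uE' (big_fsetD1 a) ?fset1U1 //=.
rewrite ifT // big_seq big1 ?addr0 ?subrr // => b.
by rewrite in_fsetD1 => /andP[/negPf ->].
Qed.

Implicit Types (a b c q r : elt Q) (W : monideal).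

(* [a *+ n = q + r] in [Q] says that [q] lies in the face generated by [a];
   [face_inj] is the injectivity half of Yanagawa's notion of a squarefree module. *)
Definition face_inj (N : gmodule) (K : N -> Prop) : Prop :=
  forall a q r n, eval a *+ n = eval q + eval r ->
  forall v, gcomp (eval a) v -> K v -> << q >> *: v = 0 -> v = 0.

(** The surjectivity that lets [image_face_inj] divide by [x^q]; it holds for sums of cyclic modules
    generated in degree 0. *)
Definition degree_gen (N : gmodule) : Prop :=
  forall a q (v : N), gcomp (eval (mmul q a)) v ->
  exists2 u, gcomp (eval a) u & v = << q >> *: u.

Definition face_closed W : Prop :=
  forall a q r n, eval a *+ n = eval q + eval r ->
  << mmul q a >> \in W -> << a >> \in W.

Lemma monom_scaleM q (x : k) a : << q >> * << x *g a >> = << x *g mmul q a >> :> kQ.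
Proof. by rewrite malgM_def fgmulUU mul1r. Qed.

Lemma gquot_degree_gen W : degree_gen (gquot W).
Proof.
move=> a q v /gquot_compE[x ->]; exists (pi W << x *g a >>).
  exact: gquot_compU.
by rewrite pi_scale monom_scaleM.
Qed.

Lemma qsum_degree_gen n (V : 'I_n -> monideal) : degree_gen (qsum V).
Proof.
move=> a q v va.
have /fin_all_exists2[u ua uE] j := gquot_degree_gen (va j).
exists (dsum_mk u : qsum V) => [j|]; first by rewrite dsumE.
by apply: dsumP => j; rewrite dsum_coordZ dsumE.
Qed.

Lemma gquot_face_inj W : face_closed W -> face_inj (fun _ : gquot W => True).
Proof.
move=> Wc a q r n e v /gquot_compE[x ->] _; rewrite pi_scale monom_scaleM.
move/pi_eq0; rewrite monom_scale_mem => xW; apply/pi_eq0.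
rewrite monom_scale_mem; apply/orP.
by case/orP: xW => [x0|/(Wc _ _ _ _ e) aW]; [left | right].
Qed.

Lemma qsum_face_inj n (V : 'I_n -> monideal) :
  (forall j, face_closed (V j)) -> face_inj (fun _ : qsum V => True).
Proof.
move=> Vc a q r m e v va _ qv; apply: dsumP => j; rewrite dsum_coord0.
apply: (gquot_face_inj (Vc j) e (va j)) => //.
by rewrite -dsum_coordZ qv dsum_coord0.
Qed.

(** If [na = q + r], then [x^((n+1)a) = x^r x^(q+a)]. *)
Lemma radical_face_closed W : radical W -> face_closed W.
Proof.
move=> radW a q r n e qaW; apply: (radW _ n.+1).
have XE m : << a >> ^+ m.+1 = << iter m (mmul a) a >> :> kQ.
  elim: m => [|m IHm]; first exact: expr1.
  by apply: etrans (exprS _ _) _; apply: etrans (congr1 _ IHm) (monomM _ _ _).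
rewrite XE (_ : iter n (mmul a) a = mmul r (mmul q a)); first exact: monomM_mem.
apply: val_inj; rewrite /= addrA [eval r + _]addrC -e -mulrSr; elim: n {e XE} => //= n ->.
by rewrite -mulrS.
Qed.

(** A diagram chase: if [x^q g(u') = 0], then [x^q u' = f(w)] and [w = x^q z] with [z] of degree
    [a]; injectivity on [M] gives [u' = f(z)], so [g(u') = 0]. *)
Lemma image_face_inj (L M N : gmodule) (f : ghom L M) (g : ghom M N) :
    degree_gen L -> face_inj (fun _ : M => True) ->
    (forall v, g v = 0 <-> exists u, v = f u) ->
  face_inj (fun v => exists u, v = g u).
Proof.
move=> genL injM ex a q r n e v va [u vE].
have [u' u'a uE] : exists2 u', gcomp (eval a) u' & g u = g u'.
  by apply: homogeneous_preimage; rewrite -vE.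
rewrite vE uE -linearZ => /ex[w0 wE].
have [w wa wE'] : exists2 w, gcomp (eval (mmul q a)) w & f w0 = f w.
  by apply: homogeneous_preimage; rewrite -wE; apply: gcompZ1.
have [z za zE] := genL _ _ _ wa.
have u'E : u' = f z.
  apply/eqP; rewrite -subr_eq0; apply/eqP; apply: (injM _ _ _ _ e) => //.
    by apply: gcompB => //; apply: ghomP.
  by rewrite scalerBr wE wE' zE linearZ subrr.
by apply/ex; exists z.
Qed.

(* If [x^(q+a)] is in [W j] but [x^a] is not, then [q] kills a multiple of [x^a]
   that lies in [K]. *)
Lemma essential_face_closed n (V : 'I_n -> monideal) (K : qsum V -> Prop) j :
    irreducible (V j) -> face_inj K -> (forall f v, K v -> K (f *: v)) ->
    (exists2 c, << c >> \notin V j &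
      K (dsum_inj (T := fun j => gquot (V j)) (pi (V j) << c >>))) ->
  face_closed (V j).
Proof.
move=> irrV injK KZ [c cV Kc] a q r m e qaV; apply/negPn/negP => aV.
have [u [w [uw uaV]]] := irreducible_directed irrV aV cV.
case/negP: uaV; apply/pi_eq0.
have [inj injE] := ghom_inj (fun j => gquot (V j)) j.
(* [q] stays in the face generated by [u + a]: the other summand [r] grows by [m] copies of [u]. *)
have e' : eval (mmul u a) *+ m = eval q + eval (mmul r (iter m (mmul u) (elt0 Q))).
  have iterE : eval (iter m (mmul u) (elt0 Q)) = eval u *+ m.
    by elim: (m) => [|l IHl] //=; rewrite IHl mulrS.
  by rewrite /= iterE mulrnDl e addrC addrA.
suff v0 : inj (pi (V j) << mmul u a >>) = 0.
  rewrite -(dsum_injK (T := fun j => gquot (V j)) (pi (V j) << mmul u a >>)).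
  by rewrite -injE v0 dsum_coord0.
apply: (injK _ _ _ _ e').
- by apply: ghomP; apply: gquot_compU.
- by rewrite uw -monomM -pi_scale linearZ injE; apply: KZ.
rewrite -linearZ pi_scale monomM (_ : pi _ _ = 0) ?linear0 //.
have -> : mmul q (mmul u a) = mmul u (mmul q a).
  by apply: val_inj; rewrite /= addrCA.
by apply/pi_eq0; apply: monomM_mem.
Qed.

(** Otherwise the summand splits off, and cancelling it lowers [mu R i]. That term [i + 2] grows
    does no harm, as minimality bounds each index separately. *)
Lemma minimal_essential (M : gmodule) (R : irr_resolution M) i (j : 'I_(mu R i)) :
    minimal_resolution R ->
  exists2 c : elt Q, << c >> \notin irr_ideal j &
    differential R i (dsum_inj (T := fun j => gquot (irr_ideal j))
      (pi (irr_ideal j) << c >>)) = 0.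
Proof.
move=> minR; have [inj injE] := ghom_inj (fun j : 'I_(mu R i) => gquot (irr_ideal j)) j.
have [phi phiE] := ghom_comp inj (differential R i).
have [[c cW c0]|[r rK]] := kills_monomial_or_splits phi (@irr_idealP _ _ _ _ R i j).
  by exists c => //; rewrite -injE -phiE.
have rK' e : r (differential R i
    (dsum_inj (T := fun j : 'I_(mu R i) => gquot (irr_ideal j)) e)) = e.
  by rewrite -injE -phiE.
have [t tE] := cancel_summand (resolution_tail R i.+2) (@irr_idealP _ _ _ _ R i)
  (@irr_idealP _ _ _ _ R i.+1) (@irr_idealP _ _ _ _ R i.+2) (@exact_prior _ _ _ _ R i)
  (@exact_termS _ _ _ _ R i) rK'.
have [R' R'E] := resolution_of_tail 0 t.
have := minR R' i; rewrite -[i in mu R' i]addn0 R'E tE.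
by rewrite leqNgt ltn_predL (leq_ltn_trans _ (ltn_ord j)).
Qed.

Lemma minimal_face_closed W (R : irr_resolution (gquot W)) :
    radical W -> minimal_resolution R ->
  forall i (j : 'I_(mu R i)), face_closed (irr_ideal j).
Proof.
move=> radW minR; pose K i (v : term R i) := exists u, v = prior_map R i u.
have step i : face_inj (@K i) -> forall j : 'I_(mu R i), face_closed (irr_ideal j).
  move=> injK j; apply: (essential_face_closed (@irr_idealP _ _ _ _ R i j) injK).
    by move=> f v [u ->]; exists (f *: u); rewrite linearZ.
  have [c cW c0] := minimal_essential j minR.
  by exists c => //; apply/exact_prior.
have gen i : degree_gen (prior R i).
  by case: i => [|i]; [apply: gquot_degree_gen | apply: qsum_degree_gen].
elim=> [|i IHi]; apply: step; last first.
  by apply: (image_face_inj (gen i) (qsum_face_inj IHi)); apply: exact_prior.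
(* At index 0 the cosyzygy is the image of [k[Q]/W], where the claim follows from radicality through
   the injective augmentation. *)
move=> a q r n e v va [u vE]; move: va; rewrite vE => va qv.
have [u' u'a uE] := homogeneous_preimage va.
rewrite uE; rewrite uE in qv.
rewrite (_ : u' = 0) ?linear0 //.
apply: (gquot_face_inj (radical_face_closed radW) e u'a) => //.
by apply: (@augmentation_inj _ _ _ _ R); rewrite linearZ linear0.
Qed.

Lemma face_of_ideal W : affine_monoid Q -> irreducible W -> face_closed W ->
    (exists c, << c >> \notin W) ->
  exists F : face Q, giso (gquot W) (face_module k F).
Proof.
move=> affQ irrW Wc [c cW].
pose P : {pred Zd} := fun v =>
  if insub v is Some a then (<< a : elt Q >> : kQ) \notin W else false.
have PE a : (eval a \in P) = (<< a >> \notin W) by rewrite unfold_in /P valK.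
have PQ : {subset P <= Q}.
  by move=> v; rewrite unfold_in /P; case: insubP => // a aQ _ _.
have P0 : 0 \in P.
  rewrite -[0]/(eval (elt0 Q)) PE; apply: contra cW => W0.
  have <- : mmul c (elt0 Q) = c by apply: val_inj; rewrite /= addr0.
  exact: monomM_mem.
have PD : {in Q &, forall v w, (v + w \in P) = (v \in P) && (w \in P)}.
  move=> v w vQ wQ; have -> : v + w = eval (mmul (Elt vQ) (Elt wQ)) by [].
  rewrite PE -[v in RHS]/(eval (Elt vQ)) -[w in RHS]/(eval (Elt wQ)) !PE.
  move: (Elt vQ) (Elt wQ) => a b; apply/idP/andP => [abW|[aW bW]].
    split; apply: contra abW; last exact: monomM_mem.
    have -> : mmul a b = mmul b a by apply: val_inj; rewrite /= addrC.
    exact: monomM_mem.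
  have [q [r [qr gW]]] := irreducible_directed irrW aW bW.
  (* With [g = q + a = r + b] outside [W], face-closedness for [g = g + 0] keeps
     [2g = (q + r) + (a + b)] outside, hence [a + b] too. *)
  have g2W : << mmul (mmul q a) (mmul q a) >> \notin W.
    apply: contra gW; apply: (Wc _ _ (elt0 Q) 1%N).
    by rewrite mulr1n addr0.
  apply: contra g2W => /(monomM_mem (mmul q r)).
  suff -> : mmul (mmul q r) (mmul a b) = mmul (mmul q a) (mmul q a) by [].
  by rewrite {2}qr; apply: val_inj; rewrite /= addrACA.
have [l lP] := prime_complement_face affQ P0 PQ PD.
pose F := Face (ex_intro _ l lP); exists F.
have FE a : (eval a \in F) = (<< a >> \notin W) by rewrite -PE.
apply: giso_quot => f fW.
  by apply/allP => b bf; rewrite FE negbK; apply: monidealP bf.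
apply/negPn/negP => /monom_notin[b bf]; rewrite -FE => bF.
by move/allP: fW => /(_ b bf); rewrite bF.
Qed.
End Support.

Theorem corollary3p5 (k : fieldType) (d : nat) (Q : pmonoid d)
    (affineQ : affine_monoid Q) (normalQ : normal_monoid Q)
    (generatesQ : generates Q)
    (I : monideal k Q) (radicalI : radical I)
    (R : irr_resolution (gquot I)) (minimalR : minimal_resolution R)
    (i : nat) (j : 'I_(mu R i)) :
  exists F : face Q, giso (summand (i := i) j) (face_module k F).
Proof.
apply: (face_of_ideal affineQ (@irr_idealP _ _ _ _ R i j)).
  exact: minimal_face_closed minimalR _ _.
(* Essentiality also excludes the unit ideal, which [irreducible] admits. *)
by have [c cW _] := minimal_essential j minimalR; exists c.
Qed.
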